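(* Let $\mathcal{H}$ be a separable right quaternionic Hilbert space and let $T\in\mathcal{B}(\mathcal{H})$ be a complex operator with respect to an orthonormal basis $\mathcal{E}$, with associated complex Hilbert space $\mathcal{H}_{\mathbb{C}}$. Then $$B(T)=\{\langle Tx,x\rangle+\langle T^*y,y\rangle:\ (x,y)\in\mathbb{S}_{\mathcal{H}_{\mathbb{C}}^2},\ \langle (T-T^* )y,x\rangle=0\}.$$
   Context: $\mathbb{H}$ denotes the real quaternions with basis $\{1,i,j,k\}$, and $\mathbb{C}=\mathrm{span}_{\mathbb{R}}\{1,i\}\subset\mathbb{H}$. $\mathcal{H}$ is a right quaternionic Hilbert space with inner product $\langle\cdot,\cdot\rangle$ that is right $\mathbb{H}$-linear in the first variable, satisfies $\langle x,y\rangle=\langle y,x\rangle^*$ and is positive definite; $\mathcal{H}$ is separable, with countable orthonormal bases indexed by $\mathbb{N}$. $\mathcal{B}(\mathcal{H})$ is the set of bounded right $\mathbb{H}$-linear operators on $\mathcal{H}$. The quaternionic numerical range is $W(T)=\{\langle Tx,x\rangle:x\in\mathcal{H},\|x\|=1\}\subset\mathbb{H}$, and the bild of $T$ is $B(T)=W(T)\cap\mathbb{C}$. $T$ is a complex operator if there is an orthonormal basis $\mathcal{E}=\{e_n:n\in\mathbb{N}\}$ of $\mathcal{H}$ with $\langle Te_n,e_m\rangle\in\mathbb{C}$ for all $n,m$. $\mathcal{H}_{\mathbb{C}}=\overline{\mathrm{span}_{\mathbb{C}}\,\mathcal{E}}$ is the right complex Hilbert space with orthonormal basis $\mathcal{E}$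 (with restricted inner product, which is $\mathbb{C}$-valued on it); every $u\in\mathcal{H}$ is uniquely $u=x+yj$ with $x,y\in\mathcal{H}_{\mathbb{C}}$, and $\|u\|^2=\|x\|^2+\|y\|^2$. $\mathbb{S}_{\mathcal{H}_{\mathbb{C}}^2}=\{(x,y)\in\mathcal{H}_{\mathbb{C}}^2:\|x\|^2+\|y\|^2=1\}$. *)

(* Defs.v *)
From HB Require Import structures.
From mathcomp Require Import all_boot all_order all_algebra.
From mathcomp Require Import ring.
From mathcomp Require Import all_classical all_reals all_analysis.

Set Implicit Arguments.
Unset Strict Implicit.
Unset Printing Implicit Defensive.

Import Order.TTheory GRing.Theory Num.Theory.
Import numFieldNormedType.Exports.

Local Open Scope classical_set_scope.
Local Open Scope ring_scope.

(* The real quaternion  qRe + qI i + qJ j + qK k. *)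
Record quat (R : realType) := Quat { qRe : R; qI : R; qJ : R; qK : R }.

Section Quaternions.
Variable R : realType.
Implicit Types p q r : quat R.

Definition quat_tuple q : R * R * R * R := (qRe q, qI q, qJ q, qK q).
Definition tuple_quat (t : R * R * R * R) : quat R :=
  let: (a, b, c, d) := t in Quat a b c d.

Lemma quat_tupleK : cancel quat_tuple tuple_quat.
Proof. by case. Qed.

HB.instance Definition _ := Choice.copy (quat R) (can_type quat_tupleK).

Definition quat_add p q :=
  Quat (qRe p + qRe q) (qI p + qI q) (qJ p + qJ q) (qK p + qK q).
Definition quat_opp p := Quat (- qRe p) (- qI p) (- qJ p) (- qK p).
Definition quat_mul p q :=
  Quat (qRe p * qRe q - qI p * qI q - qJ p * qJ q - qK p * qK q)
       (qRe p * qI q + qI p * qRe q + qJ p * qK q - qK p * qJ q)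
       (qRe p * qJ q - qI p * qK q + qJ p * qRe q + qK p * qI q)
       (qRe p * qK q + qI p * qJ q - qJ p * qI q + qK p * qRe q).

Definition quat_real (a : R) := Quat a 0 0 0.

Lemma quat_addA : associative quat_add.
Proof. by move=> p q r; rewrite /quat_add /= !addrA. Qed.
Lemma quat_addC : commutative quat_add.
Proof. by move=> p q; congr Quat; apply: addrC. Qed.
Lemma quat_add0q : left_id (quat_real 0) quat_add.
Proof. by case=> a b c d; rewrite /quat_add /= !add0r. Qed.
Lemma quat_addNq : left_inverse (quat_real 0) quat_opp quat_add.
Proof. by case=> a b c d; rewrite /quat_add /= !addNr. Qed.

HB.instance Definition _ :=
  GRing.isZmodule.Build (quat R) quat_addA quat_addC quat_add0q quat_addNq.

Lemma quat_mulA : associative quat_mul.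
Proof. by move=> p q r; congr Quat => /=; ring. Qed.
Lemma quat_mul1q : left_id (quat_real 1) quat_mul.
Proof. by case=> a b c d; congr Quat => /=; ring. Qed.
Lemma quat_mulq1 : right_id (quat_real 1) quat_mul.
Proof. by case=> a b c d; congr Quat => /=; ring. Qed.
Lemma quat_mulDl : left_distributive quat_mul quat_add.
Proof. by move=> p q r; congr Quat => /=; ring. Qed.
Lemma quat_mulDr : right_distributive quat_mul quat_add.
Proof. by move=> p q r; congr Quat => /=; ring. Qed.
Lemma quat_one_neq0 : quat_real 1 != 0 :> quat R.
Proof. by apply/eqP => /(congr1 (@qRe R)) /eqP; rewrite oner_eq0. Qed.

HB.instance Definition _ := GRing.Zmodule_isNzRing.Build (quat R)
  quat_mulA quat_mul1q quat_mulq1 quat_mulDl quat_mulDr quat_one_neq0.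

Definition qconj q := Quat (qRe q) (- qI q) (- qJ q) (- qK q).

(* The complex numbers, span_R {1, i}, inside the quaternions. *)
Definition quat_complex : set (quat R) := [set q | qJ q = 0 /\ qK q = 0].

End Quaternions.

(* A right quaternionic Hilbert space is presented over its underlying real
   Banach space; rscale v q stands for "v q". *)
HB.mixin Record isRightQuatHilbert (R : realType) V
    of CompleteNormedModule R V := {
  rscale : V -> quat R -> V;
  rscaleDl : forall (u v : V) (q : quat R),
    rscale (u + v) q = rscale u q + rscale v q;
  rscaleDr : forall (v : V) (p q : quat R),
    rscale v (p + q) = rscale v p + rscale v q;
  rscaleA : forall (v : V) (p q : quat R),
    rscale v (p * q) = rscale (rscale v p) q;
  (* In particular rscale v 1 = v. *)
  rscale_real : forall (v : V) (a : R), rscale v (quat_real a) = a *: v;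
  qdot : V -> V -> quat R;
  qdotDl : forall x y z : V, qdot (x + y) z = qdot x z + qdot y z;
  qdotZl : forall (x y : V) (q : quat R), qdot (rscale x q) y = qdot x y * q;
  qdotC : forall x y : V, qdot x y = qconj (qdot y x);
  (* The norm being definite, this includes positive definiteness of qdot. *)
  qdotxx : forall x : V, qdot x x = quat_real (`|x| ^+ 2) }.

#[short(type="rightQuatHilbertType")]
HB.structure Definition RightQuatHilbert (R : realType) :=
  {V of isRightQuatHilbert R V & CompleteNormedModule R V}.

Definition separable_space (X : topologicalType) :=
  exists D : set X, countable D /\ dense D.

Section Operators.
Variables (R : realType) (V : rightQuatHilbertType R).
Implicit Types (e : nat -> V) (A : set (quat R)).

(* Right linear combinations of the e_n with coefficients in A. *)
Definition rspan A e : set V :=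
  [set v | exists n (c : nat -> quat R), (forall k, A (c k)) /\
     v = \sum_(k < n) rscale (e k) (c k)].

Definition orthonormal_seq e := forall n m, qdot (e n) (e m) = (n == m)%:R.

Definition orthonormal_basis e :=
  orthonormal_seq e /\ closure (rspan [set: quat R] e) = [set: V].

(* H_C, for the orthonormal basis e. *)
Definition complex_hilbert e : set V := closure (rspan (@quat_complex R) e).

(* B(H): the bounded right quaternionic-linear operators. *)
Definition bounded_operator (T : V -> V) :=
  [/\ forall x y, T (x + y) = T x + T y,
      forall x (q : quat R), T (rscale x q) = rscale (T x) q &
      exists M : R, forall x, `|T x| <= M * `|x|].

(* The adjoint is characterized by <T x, y> = <x, adjoint T y>; for bounded
   right linear T the vector selected here exists (Riesz) and is unique. *)
Definition adjoint (T : V -> V) (y : V) : V :=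
  get [set z | forall x, qdot (T x) y = qdot x z].

Definition complex_operator_wrt e (T : V -> V) :=
  orthonormal_basis e /\ forall n m, quat_complex (qdot (T (e n)) (e m)).

Definition numerical_range (T : V -> V) : set (quat R) :=
  [set qdot (T x) x | x in [set x : V | `|x| = 1]].

Definition bild (T : V -> V) : set (quat R) :=
  numerical_range T `&` @quat_complex R.

Definition complex_sphere2 e : set (V * V) :=
  [set xy | [/\ complex_hilbert e xy.1, complex_hilbert e xy.2 &
                `|xy.1| ^+ 2 + `|xy.2| ^+ 2 = 1]].

End Operators.

(* Main.v *)
(* Every u in H is x + y j with x, y in H_C: on the span of the basis this splits
   each coefficient as a + b j, and it passes to limits because
   |x + y j|^2 = |x|^2 + |y|^2. As <Tx, y> is complex for x, y in H_C and
   conj(j) c j = conj(c) for complex c, expanding gives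
   <Tu, u> = (<Tx, x> + <T^* y, y>) + <(T - T^* )y, x> j,
   where both the bracket and the coefficient of j are complex. Hence <Tu, u> is
   complex exactly when <(T - T^* )y, x> = 0. *)
Require Import Defs.
From HB Require Import structures.
From mathcomp Require Import all_boot all_order all_algebra.
From mathcomp Require Import ring lra.
From mathcomp Require Import all_classical all_reals all_analysis.

Set Implicit Arguments.
Unset Strict Implicit.
Unset Printing Implicit Defensive.

Import Order.TTheory GRing.Theory Num.Theory.
Import numFieldNormedType.Exports.

Local Open Scope classical_set_scope.
Local Open Scope ring_scope.

(** * Sequential closure and Cauchy sequences *)

Section Sequences.
Variable R : realType.

Lemma closure_sequence (V : normedModType R) (A : set V) u :
  closure A u -> exists2 s : nat -> V, (forall n, A (s n)) & s @ \oo --> u.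
Proof.
move=> clAu.
have near_u n : exists v, A v /\ `|u - v| < n.+1%:R^-1.
  have n0 : 0 < n.+1%:R^-1 :> R by rewrite invr_gt0 ltr0n.
  have [v [Av uv]] := clAu _ (nbhsx_ballx u _ n0).
  by exists v; split=> //; rewrite -ball_normE in uv.
have [s sP] := choice near_u.
exists s => [n|]; first by have [] := sP n.
apply/cvgrPdist_lt => eps eps0.
near=> n.
have [_ /lt_trans->//] := sP n.
near: n.
exact: (near_infty_natSinv_lt (PosNum eps0)).
Unshelve. all: by end_near. Qed.

Lemma sequence_closure (V : normedModType R) (A : set V) (s : nat -> V) u :
  (forall n, A (s n)) -> s @ \oo --> u -> closure A u.
Proof.
move=> As su B /su[N _ sB].
by exists (s N); split; [exact: As | apply: sB => /=].
Qed.

(** Here and in [close_cvgn] the Cauchy condition compares only with one earlier index [N], which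
    suits estimates valid for ordered indices, such as those on the partial sums in
    [adjoint_exists]. *)
Lemma cvgn_close (V : normedModType R) (u : nat -> V) :
  cvgn u -> forall eps, 0 < eps ->
  exists N, forall n, (N <= n)%N -> `|u N - u n| < eps.
Proof.
move=> cu eps eps0.
have /cvgrPdist_lt uL : u @ \oo --> lim (u @ \oo) by [].
have eps2 : 0 < eps / 2 by rewrite divr_gt0.
have [N _ uN] := uL _ eps2; exists N => n Nn.
rewrite [ltRHS]splitr (le_lt_trans (ler_distD (lim (u @ \oo)) _ _))//.
by rewrite distrC ltrD// uN //=.
Qed.

Lemma close_cvgn (V : completeNormedModType R) (u : nat -> V) :
  (forall eps, 0 < eps ->
    exists N, forall n, (N <= n)%N -> `|u N - u n| < eps) -> cvgn u.
Proof.
move=> uC; apply: cauchy_cvg; apply: cauchy_exP => eps /uC[N uN].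
exists (u N); exists N => // n /= Nn.
by rewrite -ball_normE /ball_ /=; exact: uN.
Qed.

End Sequences.

(** * Quaternion algebra and the complex subfield *)

Section QuatTheory.
Variable R : realType.
Implicit Types p q r : quat R.

Lemma quat_ext p q :
  qRe p = qRe q -> qI p = qI q -> qJ p = qJ q -> qK p = qK q -> p = q.
Proof. by case: p q => ? ? ? ? [? ? ? ?] /= -> -> -> ->. Qed.

Lemma qconj_is_zmod_morphism : zmod_morphism (@qconj R).
Proof. by move=> p q; apply: quat_ext => //=; rewrite opprD. Qed.

HB.instance Definition _ :=
  GRing.isZmodMorphism.Build (quat R) (quat R) (@qconj R) qconj_is_zmod_morphism.

Lemma qRe_is_zmod_morphism : zmod_morphism (@qRe R).
Proof. by []. Qed.

HB.instance Definition _ :=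
  GRing.isZmodMorphism.Build (quat R) R (@qRe R) qRe_is_zmod_morphism.

Lemma qconjM p q : qconj (p * q) = qconj q * qconj p.
Proof. by apply: quat_ext => /=; ring. Qed.

Lemma qconjK : involutive (@qconj R).
Proof. by move=> p; apply: quat_ext => /=; rewrite ?opprK. Qed.

(** Taking [r] among 1, i, j, k reads off each coordinate up to sign. Quaternionic identities thus
    reduce to real parts, where polarization and real limits apply. *)
Lemma quat_ext_re p q : (forall r, qRe (p * r) = qRe (q * r)) -> p = q.
Proof.
move=> pq; have := (pq (Quat 1 0 0 0), pq (Quat 0 1 0 0),
  (pq (Quat 0 0 1 0), pq (Quat 0 0 0 1))).
by move=> /= [[h1 h2] [h3 h4]]; apply: quat_ext; lra.
Qed.

Definition qj : quat R := Quat 0 0 1 0.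
Definition qk : quat R := Quat 0 0 0 1.

Lemma qJ_re q : qJ q = - qRe (q * qj).
Proof. by rewrite /=; ring. Qed.

Lemma qK_re q : qK q = - qRe (q * qk).
Proof. by rewrite /=; ring. Qed.

Lemma quat_complexD p q :
  quat_complex p -> quat_complex q -> quat_complex (p + q).
Proof. by move=> [p3 p4] [q3 q4]; split=> /=; rewrite ?p3 ?q3 ?p4 ?q4 addr0. Qed.

Lemma quat_complexN p : quat_complex p -> quat_complex (- p).
Proof. by move=> [p3 p4]; split=> /=; rewrite ?p3 ?p4 oppr0. Qed.

Lemma quat_complexM p q :
  quat_complex p -> quat_complex q -> quat_complex (p * q).
Proof.
by move=> [p3 p4] [q3 q4]; split=> /=; rewrite p3 q3 p4 q4; ring.
Qed.

Lemma quat_complex_conj p : quat_complex p -> quat_complex (qconj p).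
Proof. by move=> [p3 p4]; split=> /=; rewrite ?p3 ?p4 oppr0. Qed.

Lemma quat_complex_sum n (F : 'I_n -> quat R) :
  (forall k, quat_complex (F k)) -> quat_complex (\sum_(k < n) F k).
Proof. by move=> cF; elim/big_ind: _ => //; exact: quat_complexD. Qed.

(** For complex [p], moving j across [p] conjugates it, and [qconj qj * qj = 1]. *)
Lemma qconj_qj_mulqj p : quat_complex p -> qconj qj * (p * qj) = qconj p.
Proof. by move=> [p3 p4]; apply: quat_ext => /=; rewrite ?p3 ?p4; ring. Qed.

Lemma qconj_qj_mul p : quat_complex p -> qconj qj * p = - (qconj p * qj).
Proof. by move=> [p3 p4]; apply: quat_ext => /=; rewrite ?p3 ?p4; ring. Qed.

(** For complex [q], the product [q * qj] lies in the real span of j and k, which meets the complex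
    numbers only in 0. *)
Lemma quat_complexDj p q : quat_complex p -> quat_complex q ->
  quat_complex (p + q * qj) -> q = 0.
Proof.
move=> [p3 p4] [q3 q4] [/= h3 h4].
by apply: quat_ext => //=; move: h3 h4; rewrite p3 p4 q3 q4; lra.
Qed.

Lemma quat_split q :
  q = Quat (qRe q) (qI q) 0 0 + Quat (qJ q) (qK q) 0 0 * qj.
Proof. by apply: quat_ext => /=; ring. Qed.

End QuatTheory.
Arguments qj {R}.
Arguments qk {R}.

(** * Sesquilinearity, polarization and continuity of the inner product *)

Section InnerProduct.
Variables (R : realType) (V : rightQuatHilbertType R).
Implicit Types (x y z u v : V) (q : quat R).

Lemma rscale_is_zmod_morphism q : zmod_morphism (fun v : V => rscale v q).
Proof.
by move=> u v; apply: (addIr (rscale v q)); rewrite -rscaleDl !subrK.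
Qed.

Lemma qdotBl x y z : qdot (x - y) z = qdot x z - qdot y z.
Proof. by apply: (addIr (qdot y z)); rewrite -qdotDl !subrK. Qed.

Lemma qdot_suml n (F : 'I_n -> V) y :
  qdot (\sum_(k < n) F k) y = \sum_(k < n) qdot (F k) y.
Proof.
apply: (big_morph (fun x => qdot x y)) => [x z|]; first exact: qdotDl.
by rewrite -[X in qdot X _](subrr 0) qdotBl subrr.
Qed.

Lemma rscale_suml n (F : 'I_n -> V) q :
  rscale (\sum_(k < n) F k) q = \sum_(k < n) rscale (F k) q.
Proof.
apply: (big_morph (fun v => rscale v q)) => [x z|]; first exact: rscaleDl.
by rewrite -[X in rscale X _](subrr 0) rscale_is_zmod_morphism subrr.
Qed.

Lemma qdotDr x y z : qdot x (y + z) = qdot x y + qdot x z.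
Proof. by rewrite qdotC qdotDl raddfD /= -(qdotC x y) -(qdotC x z). Qed.

Lemma qdotBr x y z : qdot x (y - z) = qdot x y - qdot x z.
Proof. by rewrite qdotC qdotBl raddfB /= -(qdotC x y) -(qdotC x z). Qed.

Lemma qdotZr x y q : qdot x (rscale y q) = qconj q * qdot x y.
Proof. by rewrite qdotC qdotZl qconjM -(qdotC x y). Qed.

Lemma qdot_sumr n x (F : 'I_n -> V) :
  qdot x (\sum_(k < n) F k) = \sum_(k < n) qdot x (F k).
Proof.
by rewrite qdotC qdot_suml raddf_sum; apply: eq_bigr => k _; rewrite [RHS]qdotC.
Qed.

Lemma qRe_qdotC x y : qRe (qdot x y) = qRe (qdot y x).
Proof. by rewrite qdotC. Qed.

Lemma sqr_normD x y : `|x + y| ^+ 2 = `|x| ^+ 2 + qRe (qdot x y) *+ 2 + `|y| ^+ 2.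
Proof.
have normE z : `|z| ^+ 2 = qRe (qdot z z) by rewrite qdotxx.
rewrite !normE qdotDl !qdotDr !raddfD /= (qRe_qdotC y x); ring.
Qed.

(** Polarization turns continuity of the real part of [qdot] into continuity of the norm. *)
Lemma qRe_qdot_polar x y :
  qRe (qdot x y) = (`|x + y| ^+ 2 - `|x| ^+ 2 - `|y| ^+ 2) / 2.
Proof. by rewrite sqr_normD; lra. Qed.

(** Cauchy-Schwarz for real parts is the squared triangle inequality with the squares cancelled. *)
Lemma qRe_qdot_le x y : qRe (qdot x y) <= `|x| * `|y|.
Proof.
have : `|x + y| ^+ 2 <= (`|x| + `|y|) ^+ 2.
  by rewrite ler_sqr ?nnegrE ?addr_ge0// ler_normD.
by rewrite sqr_normD; nra.
Qed.

Lemma cvg_qRe_qdot (s t : nat -> V) x y :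
  s @ \oo --> x -> t @ \oo --> y ->
  qRe (qdot (s n) (t n)) @[n --> \oo] --> qRe (qdot x y).
Proof.
move=> sx ty; rewrite qRe_qdot_polar.
under eq_fun do rewrite qRe_qdot_polar.
have cvg_sqr (r : nat -> V) z :
    r @ \oo --> z -> `|r n| ^+ 2 @[n --> \oo] --> `|z| ^+ 2.
  move=> rz; rewrite expr2; under eq_fun do rewrite expr2.
  by apply: cvgM; apply: cvg_norm.
by apply: cvgMl; apply: cvgB; [apply: cvgB|]; apply: cvg_sqr => //; apply: cvgD.
Qed.

Lemma cvg_qRe_qdotl (s : nat -> V) x y :
  s @ \oo --> x -> qRe (qdot (s n) y) @[n --> \oo] --> qRe (qdot x y).
Proof. by move=> sx; apply: cvg_qRe_qdot sx _; apply: cvg_cst. Qed.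

Lemma cvg_qRe_qdotr (s : nat -> V) x y :
  s @ \oo --> y -> qRe (qdot x (s n)) @[n --> \oo] --> qRe (qdot x y).
Proof. by apply: cvg_qRe_qdot; apply: cvg_cst. Qed.

Lemma norm_rscale x q : qconj q * q = 1 -> `|rscale x q| = `|x|.
Proof.
move=> q1; apply/eqP; rewrite -(@eqrXn2 _ 2)//; apply/eqP.
have -> : `|rscale x q| ^+ 2 = qRe (qdot (rscale x q) (rscale x q)).
  by rewrite qdotxx.
have qE : qRe q ^+ 2 + qI q ^+ 2 + qJ q ^+ 2 + qK q ^+ 2 = 1.
  by have /(congr1 (@qRe R)) /= <- := q1; ring.
by rewrite qdotZl qdotZr qdotxx /= -[RHS]mul1r -qE; ring.
Qed.

Lemma cvg_rscale (s : nat -> V) x q : qconj q * q = 1 ->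
  s @ \oo --> x -> rscale (s n) q @[n --> \oo] --> rscale x q.
Proof.
move=> q1 /cvgrPdist_lt sx; apply/cvgrPdist_lt => eps /sx.
by apply: filterS => n; rewrite -rscale_is_zmod_morphism norm_rscale.
Qed.

(** The j and k coordinates are, up to sign, real parts after right multiplication by a unit
    quaternion. That unit moves into the first argument, where [rscale] is isometric, so only real
    limits are needed. *)
Lemma lim_complex_qdot (s t : nat -> V) x y :
  (forall n, quat_complex (qdot (s n) (t n))) ->
  s @ \oo --> x -> t @ \oo --> y -> quat_complex (qdot x y).
Proof.
move=> cst sx ty.
have re_lim q : qconj q * q = 1 -> (forall n, qRe (qdot (s n) (t n) * q) = 0) ->
    qRe (qdot x y * q) = 0.
  move=> q1 st0; rewrite -qdotZl.
  have /cvg_lim <- // := cvg_qRe_qdot (cvg_rscale q1 sx) ty.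
  by under eq_fun do rewrite qdotZl st0; rewrite lim_cst.
have unit_qj : qconj qj * qj = 1 :> quat R by apply: quat_ext => /=; ring.
have unit_qk : qconj qk * qk = 1 :> quat R by apply: quat_ext => /=; ring.
split; rewrite ?qJ_re ?qK_re re_lim ?oppr0// => n; apply/eqP;
  rewrite -oppr_eq0 -?qJ_re -?qK_re; apply/eqP; by have [] := cst n.
Qed.

(** The cross term is twice the real part of [qconj qj * qdot x y], that is, twice the j coordinate
    of [qdot x y], which vanishes. *)
Lemma sqr_normDj x y : quat_complex (qdot x y) ->
  `|x + rscale y qj| ^+ 2 = `|x| ^+ 2 + `|y| ^+ 2.
Proof.
move=> [h3 h4]; rewrite sqr_normD norm_rscale; last by apply: quat_ext => /=; ring.
by rewrite qdotZr /= h3 h4; ring.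
Qed.

End InnerProduct.
Arguments cvg_qRe_qdotl {R V s x} y.
Arguments cvg_qRe_qdotr {R V s} x {y}.

(** * Bounded operators, the complex Hilbert subspace and the adjoint *)

Section Operators.
Variables (R : realType) (V : rightQuatHilbertType R).
Implicit Types (x y z u v : V) (q : quat R) (e : nat -> V) (T : V -> V).

Lemma bounded_operatorB T x y : bounded_operator T -> T (x - y) = T x - T y.
Proof. by move=> [TD _ _]; apply: (addIr (T y)); rewrite -TD !subrK. Qed.

Lemma bounded_operator_span T n e (c : nat -> quat R) : bounded_operator T ->
  T (\sum_(k < n) rscale (e k) (c k)) = \sum_(k < n) rscale (T (e k)) (c k).
Proof.
move=> TB; have [TD TZ _] := TB.
have T0 : T 0 = 0 by rewrite -[X in T X](subrr 0) bounded_operatorB// subrr.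
by rewrite (big_morph T TD T0); apply: eq_bigr => k _.
Qed.

Lemma cvg_bounded_operator T (s : nat -> V) x :
  bounded_operator T -> s @ \oo --> x -> T (s n) @[n --> \oo] --> T x.
Proof.
move=> TB /cvgrPdist_lt sx; have [_ _ [M TM]] := TB.
apply/cvgrPdist_lt => eps eps0.
(* [M] may be zero or negative; [|M| + 1] is a bound that can safely be divided by. *)
have M0 : 0 < `|M| + 1 by rewrite ltr_wpDl.
have := sx _ (divr_gt0 eps0 M0); apply: filterS => n.
rewrite -bounded_operatorB// ltr_pdivlMr// mulrC; apply: le_lt_trans.
apply: (le_trans (TM _)); apply: ler_wpM2r => //.
by rewrite (le_trans (ler_norm M))// lerDl.
Qed.

(** With this instance, [complex_qdot] also shows that [qdot] itself is complex-valued on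
    [complex_hilbert e]. *)
Lemma bounded_operator_id : bounded_operator (@id V).
Proof. by split=> //; exists 1 => x; rewrite mul1r. Qed.

(** On finite complex combinations the value is a sum of products of complex numbers; continuity of
    [T] and [lim_complex_qdot] carry this to the closure. *)
Lemma complex_qdot T e x y : bounded_operator T ->
  (forall n m, quat_complex (qdot (T (e n)) (e m))) ->
  complex_hilbert e x -> complex_hilbert e y -> quat_complex (qdot (T x) y).
Proof.
move=> TB Te /closure_sequence[s As sx] /closure_sequence[t At ty].
apply: lim_complex_qdot (cvg_bounded_operator TB sx) ty => l.
have [n [c [cC ->]]] := As l; have [m [d [dC ->]]] := At l.
rewrite bounded_operator_span// qdot_suml; apply: quat_complex_sum => k.
rewrite qdot_sumr; apply: quat_complex_sum => k'.
rewrite qdotZl qdotZr; apply: quat_complexM => //.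
by apply: quat_complexM => //; apply: quat_complex_conj.
Qed.

Lemma complex_orthonormal e : orthonormal_seq e ->
  forall n m, quat_complex (qdot (e n) (e m)).
Proof. by move=> eO n m; rewrite eO; case: (n == m). Qed.

Lemma complex_hilbert_split e u : orthonormal_basis e ->
  exists x y, [/\ complex_hilbert e x, complex_hilbert e y &
    u = x + rscale y qj].
Proof.
move=> [eO eB].
have /closure_sequence[s As su] : closure (rspan [set: quat R] e) u by rewrite eB.
have split_s n : exists xy : V * V, [/\ rspan (@quat_complex R) e xy.1,
    rspan (@quat_complex R) e xy.2 & s n = xy.1 + rscale xy.2 qj].
  have [N [c [_ ->]]] := As n.
  exists (\sum_(k < N) rscale (e k) (Quat (qRe (c k)) (qI (c k)) 0 0),
          \sum_(k < N) rscale (e k) (Quat (qJ (c k)) (qK (c k)) 0 0)); split.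
  - by exists N, (fun k => Quat (qRe (c k)) (qI (c k)) 0 0).
  - by exists N, (fun k => Quat (qJ (c k)) (qK (c k)) 0 0).
  - rewrite rscale_suml -big_split; apply: eq_bigr => k _ /=.
    by rewrite -rscaleA -rscaleDr -quat_split.
have [xy xyP] := choice split_s.
have cC x y : rspan (@quat_complex R) e x -> rspan (@quat_complex R) e y ->
    quat_complex (qdot x y).
  move=> cx cy; apply: (complex_qdot bounded_operator_id (complex_orthonormal eO));
    exact: subset_closure.
(* By Pythagoras neither component moves farther than [s] does, so both inherit its Cauchy
   property. *)
have dist n m : `|s n - s m| ^+ 2 =
    `|(xy n).1 - (xy m).1| ^+ 2 + `|(xy n).2 - (xy m).2| ^+ 2.
  have [x1 y1 ->] := xyP n; have [x2 y2 ->] := xyP m.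
  rewrite opprD addrACA -rscale_is_zmod_morphism sqr_normDj//.
  by rewrite qdotBl !qdotBr; do ![apply: quat_complexD|apply: quat_complexN];
    exact: cC.
have cvg_part (f : nat -> V) : (forall n m, `|f n - f m| <= `|s n - s m|) ->
    cvgn f.
  move=> fs; apply: close_cvgn => eps eps0.
  have [|N sN] := @cvgn_close _ _ s _ eps eps0; first by apply/cvg_ex; exists u.
  by exists N => n Nn; exact: le_lt_trans (fs _ _) (sN _ Nn).
have cx : cvgn (fun n => (xy n).1).
  apply: cvg_part => n m.
  by rewrite -(@ler_pXn2r _ 2)// ?nnegrE// dist lerDl sqr_ge0.
have cy : cvgn (fun n => (xy n).2).
  apply: cvg_part => n m.
  by rewrite -(@ler_pXn2r _ 2)// ?nnegrE// dist lerDr sqr_ge0.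
exists (lim ((xy n).1 @[n --> \oo])), (lim ((xy n).2 @[n --> \oo])); split.
- by apply: sequence_closure cx => n; have [] := xyP n.
- by apply: sequence_closure cy => n; have [] := xyP n.
- rewrite -(cvg_lim (@norm_hausdorff _ _) su); apply: cvg_lim => //.
  have -> : s = fun n => (xy n).1 + rscale (xy n).2 qj.
    by apply/funext => n; have [] := xyP n.
  apply: cvgD => //; apply: cvg_rscale => //.
  by apply: quat_ext => /=; ring.
Qed.

(* The representing vector is the limit of its would-be Fourier partial sums
   [z n]: by orthonormality they are orthogonal projections of one another, and
   boundedness of [T] bounds their norms (Bessel), so they form a Cauchy sequence. *)
Lemma adjoint_exists T e y : bounded_operator T -> orthonormal_basis e ->
  exists z, forall x, qdot (T x) y = qdot x z.
Proof.
move=> TB [eO eB]; have [TD TZ [M TM]] := TB.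
(* The conjugate compensates for the conjugate-linearity of [qdot] in its second variable. *)
pose c k := qconj (qdot (T (e k)) y).
pose z n := \sum_(k < n) rscale (e k) (c k).
have ez k n : (k < n)%N -> qdot (e k) (z n) = qdot (T (e k)) y.
  move=> kn; rewrite /z qdot_sumr (bigD1 (Ordinal kn))//= big1 => [|i ik].
    by rewrite qdotZr eO eqxx mulr1 addr0 qconjK.
  by rewrite qdotZr eO; case: eqP => [ki|_]; rewrite ?mulr0//;
    case/eqP: ik; apply/val_inj.
have zz m n : (m <= n)%N -> qdot (z m) (z n) = qdot (T (z m)) y.
  move=> mn; rewrite bounded_operator_span// {1}/z !qdot_suml.
  by apply: eq_bigr => k _; rewrite !qdotZl ez// (leq_trans (ltn_ord k)).
have normz n : `|z n| ^+ 2 = qRe (qdot (T (z n)) y) by rewrite -(zz n n)// qdotxx.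
have bound n : `|z n| <= `|M| * `|y|.
  have := qRe_qdot_le (T (z n)) y; rewrite -normz.
  have : `|T (z n)| * `|y| <= `|M| * `|z n| * `|y|.
    apply: ler_wpM2r => //; apply: le_trans (TM _) _.
    by apply: ler_wpM2r => //; exact: ler_norm.
  (* The inequality is now quadratic in the norm of [z n]; one factor cancels unless [z n] is
     zero. *)
  move=> h /le_trans/(_ h); have [->|z0] := eqVneq (z n) 0.
    by rewrite normr0 mulr_ge0.
  by rewrite expr2 mulrAC ler_pM2r// normr_gt0.
have pyth m n : (m <= n)%N -> `|z m - z n| ^+ 2 = `|z n| ^+ 2 - `|z m| ^+ 2.
  move=> mn.
  have : qRe (qdot (z m) (z n)) = `|z m| ^+ 2 by rewrite zz// normz.
  have normE v : `|v| ^+ 2 = qRe (qdot v v) by rewrite qdotxx.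
  rewrite (normE (_ - _)) qdotBl !qdotBr (normE (z n)) !raddfB /=.
  rewrite (qRe_qdotC (z n) (z m)) -(normE (z m)); lra.
have cvg_sqr : cvgn (fun n => `|z n| ^+ 2).
  apply: nondecreasing_is_cvgn.
    by move=> m n mn; rewrite -subr_ge0 -pyth// sqr_ge0.
  exists ((`|M| * `|y|) ^+ 2) => _ [n _ <-].
  by rewrite ler_sqr ?nnegrE ?mulr_ge0.
have zC : cvgn z.
  apply: close_cvgn => eps eps0.
  have [N zN] := cvgn_close cvg_sqr (exprn_gt0 2 eps0).
  exists N => n Nn; rewrite -(@ltr_pXn2r _ 2)// ?nnegrE ?(ltW eps0)//.
  rewrite pyth//; apply: le_lt_trans (zN _ Nn).
  by rewrite distrC ler_norm.
have lim_z k q : qRe (qdot (rscale (T (e k)) q) y) =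
    qRe (qdot (rscale (e k) q) (lim (z @ \oo))).
  have /(cvg_lim (@norm_hausdorff _ _)) <- :=
    cvg_qRe_qdotr (rscale (e k) q) zC.
  (* Once [n] exceeds [k], the sum [z n] contains the [k]-th term, so the sequence is constant from
     [k.+1] on. *)
  apply/esym/cvg_lim => //; apply: cvg_near_cst; exists k.+1 => // n /= kn.
  by rewrite !qdotZl ez.
have re_z x : qRe (qdot (T x) y) = qRe (qdot x (lim (z @ \oo))).
  have /closure_sequence[s As sx] : closure (rspan [set: quat R] e) x by rewrite eB.
  have Tsx := cvg_bounded_operator TB sx.
  have szE n : qRe (qdot (T (s n)) y) = qRe (qdot (s n) (lim (z @ \oo))).
    have [N [d [_ ->]]] := As n.
    rewrite bounded_operator_span// !qdot_suml !raddf_sum.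
    by apply: eq_bigr => k _ /=; exact: lim_z.
  have /(cvg_lim (@norm_hausdorff _ _)) <- := cvg_qRe_qdotl y Tsx.
  under eq_fun do rewrite szE.
  by apply: cvg_lim => //; exact: cvg_qRe_qdotl.
(* Applying [re_z] to every [rscale x q] recovers the full quaternionic identity from its real
   part. *)
exists (lim (z @ \oo)) => x; apply: quat_ext_re => q.
by rewrite -!qdotZl -TZ re_z.
Qed.

(** The value of [get] satisfies its specification only when the set is inhabited, which
    [adjoint_exists] provides. *)
Lemma adjointP T e : bounded_operator T -> orthonormal_basis e ->
  forall x y, qdot (T x) y = qdot x (adjoint T y).
Proof.
move=> TB eB x y; rewrite /adjoint.
have [z zP] := adjoint_exists y TB eB.
exact: (@getPex _ [set z | forall x, qdot (T x) y = qdot x z] (ex_intro _ z zP)).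
Qed.

Lemma qdot_split T e x y : bounded_operator T -> complex_operator_wrt e T ->
  complex_hilbert e x -> complex_hilbert e y ->
  qdot (T (x + rscale y qj)) (x + rscale y qj) =
  (qdot (T x) x + qdot (adjoint T y) y) + qdot (T y - adjoint T y) x * qj.
Proof.
move=> TB [eB Te] cx cy; have [TD TZ _] := TB.
have adjE v w : qdot (adjoint T v) w = qconj (qdot (T w) v).
  by rewrite (adjointP TB eB) -qdotC.
have cT v w : complex_hilbert e v -> complex_hilbert e w ->
  quat_complex (qdot (T v) w) by exact: complex_qdot.
(* Of the four terms, the one with j on both sides becomes [qconj (qdot (T y) y)], and the one with
   j only on the right becomes [- (qconj (qdot (T x) y) * qj)]. By [adjE] these are the two adjoint
   terms. *)
rewrite TD TZ qdotDl !qdotDr !qdotZr !qdotZl qdotBl !adjE.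
rewrite qconj_qj_mulqj ?qconj_qj_mul; try exact: cT.
by rewrite mulrBl [_ * qj + _]addrC addrACA [- _ + _]addrC.
Qed.

End Operators.

Theorem proposition3p1 (R : realType) (H : rightQuatHilbertType R)
    (Hsep : separable_space H)
    (T : H -> H) (Tbounded : bounded_operator T)
    (e : nat -> H) (Tcomplex : complex_operator_wrt e T) :
  bild T =
  [set qdot (T xy.1) xy.1 + qdot (adjoint T xy.2) xy.2 | xy in
    complex_sphere2 e `&`
    [set xy : H * H | qdot (T xy.2 - adjoint T xy.2) xy.1 = 0]].
Proof.
have [eB Te] := Tcomplex; have [eO _] := eB.
have cT x y : complex_hilbert e x -> complex_hilbert e y ->
  quat_complex (qdot (T x) y) by exact: complex_qdot.
have cTa x y : complex_hilbert e x -> complex_hilbert e y ->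
    quat_complex (qdot (adjoint T x) y).
  move=> cx cy; rewrite qdotC -(adjointP Tbounded eB).
  exact/quat_complex_conj/cT.
have normE x y : complex_hilbert e x -> complex_hilbert e y ->
    `|x + rscale y qj| ^+ 2 = `|x| ^+ 2 + `|y| ^+ 2.
  move=> cx cy; apply: sqr_normDj.
  exact: (complex_qdot (@bounded_operator_id _ _) (complex_orthonormal eO)).
apply/seteqP; split => [_ [[u u1 <-] cu]|_ [[x y] [[/= cx cy xy1] xy0] <-]].
  have [x [y [cx cy uE]]] := complex_hilbert_split u eB.
  move: cu; rewrite uE (qdot_split Tbounded Tcomplex)// => cu.
  have xy0 : qdot (T y - adjoint T y) x = 0.
    apply: quat_complexDj cu.
    - by apply: quat_complexD; [exact: cT | exact: cTa].
    - by rewrite qdotBl; apply: quat_complexD; [exact: cT|];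
        exact/quat_complexN/cTa.
  exists (x, y) => /=; last by rewrite xy0 mul0r addr0.
  by split=> //; split=> //=; rewrite -normE// -uE u1 expr1n.
split; last by apply: quat_complexD; [exact: cT | exact: cTa].
(* Reassembling the pair gives a unit vector by [normE], and the constraint kills the j part of its
   value. *)
exists (x + rscale y qj) => /=; last first.
  by rewrite (qdot_split Tbounded Tcomplex)// xy0 mul0r addr0.
by apply/eqP; rewrite -(@eqrXn2 _ 2)// expr1n normE// xy1.
Qed.
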